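(* Let $\mathbb{F}=\mathbb{R}$ or $\mathbb{F}=\mathbb{C}$, let $m\geq n\geq 1$ be integers, and let $X,Y\in M_{m\times n}(\mathbb{F})$ with $Y\neq 0$. There is an orthogonal projection $A\in M_{m}(\mathbb{F})$ such that $AX=Y$ if and only if $Y^*X=Y^*Y$.
   Context: $M_{m\times n}(\mathbb{F})$ is the set of $m\times n$ matrices over $\mathbb{F}$ and $M_m(\mathbb{F})=M_{m\times m}(\mathbb{F})$. $Z^*$ denotes the conjugate transpose of $Z$ (the transpose if $\mathbb{F}=\mathbb{R}$). $A\in M_m(\mathbb{F})$ is an orthogonal projection if $A=A^*$ and $A^2=A$. *)

(* Defs.v *)
From mathcomp Require Import all_boot all_order all_algebra.
From mathcomp Require Import reals complex.

Set Implicit Arguments.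
Unset Strict Implicit.
Unset Printing Implicit Defensive.

Import GRing.Theory Num.Theory.
Local Open Scope ring_scope.

(* Over the reals the adjoint Z^* is the transpose Z^T; over the complex
   numbers it is the library's conjugate transpose Z ^t*, that is
   map_mx Num.conj Z^T. *)
Local Open Scope sesquilinear_scope.

Definition real_orthogonal_projection (R : realType) (m : nat)
    (A : 'M[R]_m) : Prop :=
  A = A^T /\ A *m A = A.

Definition complex_orthogonal_projection (R : realType) (m : nat)
    (A : 'M[R[i]]_m) : Prop :=
  A = A ^t* /\ A *m A = A.

(* Main.v *)
Require Import Defs.
From mathcomp Require Import all_boot all_order all_algebra.
From mathcomp Require Import reals complex.

Import GRing.Theory Num.Theory.
Local Open Scope ring_scope.
Local Open Scope sesquilinear_scope.

(** If [A] is an orthogonal projection with [A X = Y], then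
    [Y^* X = X^* A X = X^* A^* A X = Y^* Y].  Conversely, take for [A] the
    orthogonal projection onto the column space of [Y]: since
    [Y^* (X - Y) = 0], it kills [X - Y], hence [A X = A Y = Y].  With [C] a
    basis of the column space of [Y], this projection is
    [C (C^* C)^-1 C^*]. *)

(* The adjoint along an arbitrary involution [f] treats both scalar fields at
   once: [f] is the identity over the reals, conjugation over the complexes. *)
Definition adjmx (F : numFieldType) (f : {rmorphism F -> F}) (m n : nat)
  (A : 'M[F]_(m, n)) : 'M[F]_(n, m) := map_mx f A^T.

Section Adjoint.

Variables (F : numFieldType) (f : {rmorphism F -> F}).
Hypotheses (fK : involutive f) (f_ge0 : forall x : F, 0 <= x * f x).

Local Notation "A ^*m" := (adjmx _ f _ _ A) (at level 2, format "A ^*m").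

Lemma adjmxK (m n : nat) (A : 'M[F]_(m, n)) : A^*m^*m = A.
Proof. by apply/matrixP => i j; rewrite !mxE fK. Qed.

Lemma adjmx_mul (m n p : nat) (A : 'M[F]_(m, n)) (B : 'M[F]_(n, p)) :
  (A *m B)^*m = B^*m *m A^*m.
Proof. by rewrite /adjmx trmx_mul map_mxM. Qed.

Lemma adjmx1 (n : nat) : (1%:M : 'M[F]_n)^*m = 1%:M.
Proof. by rewrite /adjmx trmx1 map_mx1. Qed.

Lemma adjmx_inv (n : nat) (A : 'M[F]_n) : (invmx A)^*m = invmx A^*m.
Proof. by rewrite /adjmx trmx_inv map_invmx. Qed.

(** The only entry is the sum of the [v_i * f v_i], all nonnegative by [f_ge0], so each term
    vanishes; [f] is injective, being a field morphism. *)
Lemma mulmx_adj_eq0 (n : nat) (v : 'rV[F]_n) : v *m v^*m = 0 -> v = 0.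
Proof.
move=> /matrixP /(_ ord0 ord0); rewrite !mxE => /eqP.
rewrite psumr_eq0 => [/allP v0|i _]; last by rewrite !mxE.
apply/rowP => i; have /implyP/(_ isT) := v0 i (mem_index_enum i).
by rewrite !mxE mulf_eq0 fmorph_eq0 orbb => /eqP.
Qed.

(** If [v *m (C^*m *m C) = 0], then [v *m C^*m] times its own adjoint is zero, so [v *m C^*m = 0] by
    definiteness. *)
Lemma gram_unitmx (m r : nat) (C : 'M[F]_(m, r)) :
  row_free C^*m -> C^*m *m C \in unitmx.
Proof.
move=> freeC; rewrite -row_free_unit; apply/inj_row_free => v vG0.
apply/(row_free_injr freeC); rewrite /= mul0mx; apply: mulmx_adj_eq0.
by rewrite adjmx_mul adjmxK mulmxA -(mulmxA v) vG0 mul0mx.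
Qed.

Lemma row_free_adjmx (m r : nat) (C : 'M[F]_(m, r)) :
  row_full C -> row_free C^*m.
Proof.
case/row_fullP => B BC1; apply/row_freeP; exists B^*m.
by rewrite -adjmx_mul BC1 adjmx1.
Qed.

Lemma exists_projection (m n : nat) (Y : 'M[F]_(m, n)) :
  exists A : 'M[F]_m, [/\ A = A^*m, A *m A = A, A *m Y = Y &
    forall p (W : 'M[F]_(m, p)), Y^*m *m W = 0 -> A *m W = 0].
Proof.
(* Rank factorisation [Y = C *m D]: [C] has a left inverse and [D] a right inverse [E]. *)
have := row_base_free Y; have := col_base_full Y; have := mulmx_base Y.
move: (\rank Y) (col_base Y) (row_base Y) => r C D defY fullC.
case/row_freeP=> E DE1.
have unitG : C^*m *m C \in unitmx by exact/gram_unitmx/row_free_adjmx.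
pose P := invmx (C^*m *m C) *m C^*m.
have PC : P *m C = 1%:M by rewrite -mulmxA mulVmx.
exists (C *m P); split.
- by rewrite !adjmx_mul adjmx_inv adjmx_mul adjmxK mulmxA.
- by rewrite mulmxA -(mulmxA C) PC mulmx1.
- by rewrite -defY mulmxA -(mulmxA C) PC mulmx1.
move=> p W; rewrite -defY adjmx_mul => YW0.
suff CW0 : C^*m *m W = 0 by rewrite -!mulmxA CW0 !mulmx0.
(* Since [D *m E = 1], [C^*m = E^*m *m D^*m *m C^*m = E^*m *m Y^*m]. *)
rewrite -[C^*m]mul1mx -adjmx1 -DE1 adjmx_mul -!mulmxA (mulmxA D^*m).
by rewrite YW0 mulmx0.
Qed.

Lemma projection_mulmxP (m n : nat) (X Y : 'M[F]_(m, n)) :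
  (exists A : 'M[F]_m, (A = A^*m /\ A *m A = A) /\ A *m X = Y)
  <-> Y^*m *m X = Y^*m *m Y.
Proof.
split=> [[A [[Aadj AA] <-]]|YXY].
  by rewrite adjmx_mul -Aadj mulmxA -(mulmxA X^*m A A) AA.
have [A [Aadj AA AY AW]] := exists_projection _ _ Y.
exists A; split=> //; apply/eqP; rewrite -AY -subr_eq0 -mulmxBr.
by apply/eqP/AW; rewrite mulmxBr YXY subrr.
Qed.

End Adjoint.

Theorem theorem8p1 (R : realType) (m n : nat)
    (n_ge1 : (1 <= n)%N) (n_le_m : (n <= m)%N) :
  (forall X Y : 'M[R]_(m, n), Y <> 0 ->
     (exists A : 'M[R]_m, real_orthogonal_projection A /\ A *m X = Y)
     <-> Y^T *m X = Y^T *m Y)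
  /\
  (forall X Y : 'M[R[i]]_(m, n), Y <> 0 ->
     (exists A : 'M[R[i]]_m, complex_orthogonal_projection A /\ A *m X = Y)
     <-> Y ^t* *m X = Y ^t* *m Y).
Proof.
split=> X Y _.
  (* Mapping the identity over a matrix must be rewritten away, whereas the complex adjoint below
     matches by conversion. *)
  have idE p q (B : 'M[R]_(p, q)) : adjmx R idfun p q B = B^T.
    exact: map_mx_id.
  have := projection_mulmxP R idfun (fun=> erefl) (@sqr_ge0 _) m n X Y.
  rewrite idE => <-; rewrite /real_orthogonal_projection.
  by split=> -[A HA]; exists A; move: HA; rewrite idE.
exact: (projection_mulmxP _ Num.conj (@conjCK _) (@mul_conjC_ge0 _)).
Qed.
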